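(* Let $k=\mathbb{F}_p$, let $G$ be a finite $p$-group with $|G|=p^n$, and let $A=k[a_1,\dots,a_m]\le D_k$ be a trace-surjective $G$-subalgebra (i.e. a $G$-stable $k$-subalgebra generated by $m$ elements $a_1,\dots,a_m$ which is a trace-surjective $G$-algebra). Then $m\ge n$. In particular, every standard subalgebra of $D_k$ which is a polynomial ring has Krull-dimension $\ge n$.
   Context: All group actions are right actions. A $G$-algebra is a commutative $k$-algebra $A$ on which $G$ acts by $k$-algebra automorphisms; $A$ is trace-surjective if the map $\mathrm{tr}:A\to A^G$, $a\mapsto\sum_{g\in G}ag$, is surjective. Let $V_{reg}=\bigoplus_{g\in G}kX_g$ be the regular right $kG$-module, with $(X_g)h=X_{gh}$, and $D_k=D_k(G):=\mathrm{Sym}_k(V_{reg})/(\alpha)$ with $\alpha=-1+\sum_{g\in G}X_g$, with the induced $G$-action. A trace-surjective $G$-subalgebra $U\le D_k$ is called standard if $D_k=U\oplus J$ for some $G$-stable ideal $J\unlhd D_k$. *)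

(* Defs.v *)
From HB Require Import structures.
From mathcomp Require Import all_boot all_order all_fingroup all_algebra.
From mathcomp Require Import all_solvable.
From mathcomp Require Import boolp.
From mathcomp Require Import mpoly.
Set Implicit Arguments.
Unset Strict Implicit.
Unset Printing Implicit Defensive.
Import GRing.Theory.
Local Open Scope ring_scope.
Local Open Scope quotient_scope.

(* Subsets of a ring are collective predicates {pred R}.  Reasoning is
   classical: `[< P >] turns any proposition P into a boolean, so every subset
   is of this form. *)

Section RingNotions.
Variable R : comNzRingType.
Implicit Types U J P : {pred R}.

(* Unlike idealr_closed, this does not exclude J = R. *)
Definition is_ideal J : Prop :=
  0 \in J /\ forall a, {in J &, forall u v, a * u + v \in J}.

(* Internal direct sum R = U (+) J of additive subgroups. *)
Definition is_direct_sum U J : Prop :=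
  (forall x, exists u v, [/\ u \in U, v \in J & x = u + v])
  /\ (forall x, x \in U -> x \in J -> x = 0).

(* P is a prime ideal of the ring U, where U is a subring of R. *)
Definition is_prime_ideal_of U P : Prop :=
  [/\ {subset P <= U}, 0 \in P, 1 \notin P,
      {in U, forall a, {in P &, forall u v, a * u + v \in P}}
    & {in U &, forall u v, u * v \in P -> (u \in P) || (v \in P)}].

(* P 0 < P 1 < ... < P d is a strict chain of primes of U, of length d. *)
Definition is_prime_chain U (d : nat) (P : nat -> {pred R}) : Prop :=
  (forall i, (i <= d)%N -> is_prime_ideal_of U (P i))
  /\ (forall i, (i < d)%N ->
        {subset P i <= P i.+1} /\ exists2 x, x \in P i.+1 & x \notin P i).

(* The supremum of the lengths of the strict chains of primes is >= n; this
   includes the case where it is infinite. *)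
Definition krull_dim_ge U (n : nat) : Prop :=
  exists2 d, (n <= d)%N & exists P : nat -> {pred R}, is_prime_chain U d P.

End RingNotions.

Section AlgebraNotions.
Variables (k : fieldType) (D : comAlgType k).

(* k[a_0, ..., a_(m-1)]: the values of polynomials over k at a. *)
Definition gen_subalg (m : nat) (a : 'I_m -> D) : {pred D} :=
  fun x => `[< exists q : {mpoly k[m]}, x = mmap (in_alg D) a q >].

Lemma gen_subalgP m (a : 'I_m -> D) x :
  reflect (exists q : {mpoly k[m]}, x = mmap (in_alg D) a q)
          (x \in gen_subalg a).
Proof. exact: asboolP. Qed.

Lemma mem_gen_subalg m (a : 'I_m -> D) i : a i \in gen_subalg a.
Proof. by apply/gen_subalgP; exists 'X_i; rewrite mmapX mmap1U. Qed.

Lemma gen_subalg_closed m (a : 'I_m -> D) :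
  GRing.subalg_closed (gen_subalg a).
Proof.
split.
- by apply/gen_subalgP; exists 1; rewrite rmorph1.
- move=> c _ _ /gen_subalgP[q ->] /gen_subalgP[r ->]; apply/gen_subalgP.
  by exists (c *: q + r); rewrite rmorphD /= mmapZ /= mulr_algl.
- move=> _ _ /gen_subalgP[q ->] /gen_subalgP[r ->]; apply/gen_subalgP.
  by exists (q * r); rewrite rmorphM.
Qed.

(* U is isomorphic as a k-algebra to k[x_1, ..., x_m] for some m. *)
Definition is_polynomial_ring (U : {pred D}) : Prop :=
  exists (m : nat) (f : {lrmorphism {mpoly k[m]} -> D}),
    injective f /\ forall x, x \in U <-> exists q, x = f q.

End AlgebraNotions.

Section Dk.
Variables (k : fieldType) (G : finGroupType).

(* Sym_k(V_reg), i.e. the polynomial ring over k on the basis (X_g) of V_reg. *)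
Local Notation SymV := {mpoly k[#|G|]}.

Definition Xg (g : G) : SymV := 'X_(enum_rank g).

Definition alpha : SymV := - 1 + \sum_(g : G) Xg g.

Definition alpha_ideal : {pred SymV} :=
  fun q => `[< exists r, q = r * alpha >].

Lemma alpha_idealP q : reflect (exists r, q = r * alpha) (q \in alpha_ideal).
Proof. exact: asboolP. Qed.

Lemma alpha_ideal_closed : idealr_closed alpha_ideal.
Proof.
split.
- by apply/alpha_idealP; exists 0; rewrite mul0r.
- apply/alpha_idealP => -[r /(congr1 (meval (fun i => (i == enum_rank 1%g)%:R)))].
  rewrite mevalM /alpha mevalD mevalN !meval1 raddf_sum /= (bigD1 1%g) //=.
  rewrite mevalXU eqxx big1 => [|g /negPf g1].
    by rewrite addr0 addNr mulr0 => /eqP; rewrite oner_eq0.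
  by rewrite mevalXU (inj_eq enum_rank_inj) g1.
- move=> a _ _ /alpha_idealP[r ->] /alpha_idealP[s ->].
  by apply/alpha_idealP; exists (a * r + s); rewrite mulrDl mulrA.
Qed.

HB.instance Definition _ := isIdealr.Build SymV alpha_ideal alpha_ideal_closed.

Definition Dk : Type := {ideal_quot alpha_ideal}.
HB.instance Definition _ := GRing.ComNzRing.on Dk.
HB.instance Definition _ := NzRingQuotient.on Dk.

Definition Dk_scale (c : k) (x : Dk) : Dk :=
  \pi_Dk (c *: generic_quotient.repr x).

Lemma piDM : {morph \pi_Dk : q r / q * r}.
Proof. exact: (rmorphM (\pi_Dk)). Qed.

Lemma piDD : {morph \pi_Dk : q r / q + r}.
Proof. exact: (raddfD (\pi_Dk)). Qed.

Lemma pi_scale c (q : SymV) : Dk_scale c (\pi_Dk q) = \pi_Dk (c *: q).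
Proof.
rewrite /Dk_scale -mul_mpolyC -[in RHS]mul_mpolyC.
by rewrite !piDM reprK.
Qed.

Lemma Dk_scaleA a b x : Dk_scale a (Dk_scale b x) = Dk_scale (a * b) x.
Proof. by rewrite -[x]reprK !pi_scale scalerA reprK. Qed.

Lemma Dk_scale1 : left_id 1 Dk_scale.
Proof. by move=> x; rewrite -[x]reprK pi_scale scale1r. Qed.

Lemma Dk_scaleDr : right_distributive Dk_scale +%R.
Proof.
by move=> a x y; rewrite -[x]reprK -[y]reprK -piDD !pi_scale scalerDr piDD.
Qed.

Lemma Dk_scaleDl x : {morph Dk_scale^~ x : a b / a + b}.
Proof. by move=> a b; rewrite -[x]reprK !pi_scale scalerDl piDD. Qed.

HB.instance Definition _ := GRing.Zmodule_isLmodule.Build k Dk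
  Dk_scaleA Dk_scale1 Dk_scaleDr Dk_scaleDl.

Lemma Dk_scaleAl (a : k) (x y : Dk) : a *: (x * y) = (a *: x) * y.
Proof.
change (Dk_scale a (x * y) = Dk_scale a x * y).
by rewrite -[x]reprK -[y]reprK -piDM !pi_scale -piDM scalerAl.
Qed.

HB.instance Definition _ := GRing.Lmodule_isLalgebra.Build k Dk Dk_scaleAl.
HB.instance Definition _ := GRing.Lalgebra_isComAlgebra.Build k Dk.

(* Right action of G: (X_g)h = X_{gh}, extended to a k-algebra endomorphism of
   Sym_k(V_reg), then induced on the quotient by (alpha). *)
Definition sym_act (h : G) (q : SymV) : SymV :=
  q \mPo [tuple Xg (enum_val i * h)%g | i < #|G|].

Definition act (h : G) (x : Dk) : Dk :=
  \pi_Dk (sym_act h (generic_quotient.repr x)).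

Lemma sym_actX h g : sym_act h (Xg g) = Xg (g * h)%g.
Proof.
by rewrite /sym_act comp_mpolyXU -tnth_nth tnth_mktuple enum_rankK.
Qed.

Lemma sym_act_alpha h : sym_act h alpha = alpha.
Proof.
rewrite /sym_act /alpha rmorphD rmorphN rmorph1 rmorph_sum /=; congr (_ + _).
rewrite [RHS](reindex_inj (mulIg h)) /=; apply: eq_bigr => g _.
exact: sym_actX.
Qed.

(* The action is well defined on the quotient. *)
Lemma act_pi h (q : SymV) : act h (\pi_Dk q) = \pi_Dk (sym_act h q).
Proof.
apply/eqP; rewrite -Quotient.idealrBE /sym_act -rmorphB /=.
have : generic_quotient.repr (\pi_Dk q) - q \in alpha_ideal.
  by rewrite Quotient.idealrBE reprK.
case/alpha_idealP => r ->; apply/alpha_idealP; exists (sym_act h r).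
by rewrite rmorphM /= -/(sym_act h alpha) sym_act_alpha.
Qed.

Lemma sym_act1 q : sym_act 1%g q = q.
Proof.
rewrite -[RHS]comp_mpoly_id; congr comp_mpoly; apply: eq_mktuple => i.
by rewrite mulg1 /Xg enum_valK.
Qed.

Lemma act1 x : act 1%g x = x.
Proof. by rewrite -[x]reprK act_pi sym_act1. Qed.

Lemma sym_actM g h q : sym_act (g * h)%g q = sym_act h (sym_act g q).
Proof.
elim/mpolyind: q => [|c m q _ _ IH]; first by rewrite /sym_act !rmorph0.
move: IH; rewrite /sym_act !rmorphD /= => ->; congr (_ + _).
rewrite !linearZ /=; congr (_ *: _).
rewrite !comp_mpolyX rmorph_prod /=; apply: eq_bigr => i _.
by rewrite rmorphXn /= !tnth_mktuple -/(sym_act h _) sym_actX mulgA.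
Qed.

Lemma actM g h x : act (g * h)%g x = act h (act g x).
Proof. by rewrite -[x]reprK act_pi sym_actM -!act_pi. Qed.

Lemma act_is_zmod_morphism h : zmod_morphism (act h).
Proof.
move=> x y; rewrite -[x]reprK -[y]reprK -(raddfB (\pi_Dk)) !act_pi.
by rewrite /sym_act raddfB (raddfB (\pi_Dk)).
Qed.

Lemma act_is_monoid_morphism h : monoid_morphism (act h).
Proof.
split; first by rewrite -(rmorph1 (\pi_Dk)) act_pi /sym_act comp_mpoly1.
move=> x y; rewrite -[x]reprK -[y]reprK -piDM !act_pi.
by rewrite /sym_act rmorphM piDM.
Qed.

Lemma act_is_scalable h : scalable (act h).
Proof.
move=> a x; change (act h (Dk_scale a x) = Dk_scale a (act h x)).
by rewrite -[x]reprK pi_scale !act_pi pi_scale /sym_act linearZ.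
Qed.

HB.instance Definition _ h :=
  GRing.isZmodMorphism.Build Dk Dk (act h) (act_is_zmod_morphism h).
HB.instance Definition _ h :=
  GRing.isMonoidMorphism.Build Dk Dk (act h) (act_is_monoid_morphism h).
HB.instance Definition _ h :=
  GRing.isScalable.Build k Dk Dk *:%R (act h) (act_is_scalable h).

Implicit Types U J : {pred Dk}.

Definition is_stable U : Prop := forall g, {in U, forall x, act g x \in U}.

Definition is_invariant (x : Dk) : Prop := forall g, act g x = x.

Definition tr (x : Dk) : Dk := \sum_(g : G) act g x.

Definition is_G_subalgebra U : Prop := GRing.subalg_closed U /\ is_stable U.

(* tr maps U onto the invariants U^G; it maps into U^G for every stable U. *)
Definition is_trace_surjective U : Prop :=
  {in U, forall b, is_invariant b -> exists2 a, a \in U & tr a = b}.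

Definition is_standard U : Prop :=
  [/\ is_G_subalgebra U, is_trace_surjective U
    & exists J, [/\ is_ideal J, is_stable J & is_direct_sum U J]].

End Dk.

(* Main.v *)
Require Import Defs.
From mathcomp Require Import all_boot all_fingroup all_algebra all_solvable.
From mathcomp Require Import mpoly.
From HB Require Import structures.
From mathcomp Require Import boolp.
Set Implicit Arguments.
Unset Strict Implicit.
Unset Printing Implicit Defensive.
Import GRing.Theory.
Local Open Scope ring_scope.

(** The number of generators is bounded below by counting points over the
    finite field k.  A k-point of A = k[a_1, ..., a_m] is determined by the
    values of the a_i, so there are at most #|k| ^ m of them, and G permutes
    them.  If g <> 1 fixed a point phi, then in phi (tr b) = \sum_h phi (b h)
    the terms would be constant on the left cosets of <[g]>, so that
    phi (tr b) would be a multiple of #[g], hence 0 in characteristic p; but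
    trace-surjectivity provides b with tr b = 1, and phi 1 = 1.  So G acts
    freely on the k-points of A ([orbit_map_inj]).  There is at least one such
    point, the restriction of the point X_1 = 1, X_g = 0 (g <> 1) of D_k
    ([Dk_point]), and its orbit has #|G| elements: #|G| <= #|k| ^ m
    ([card_le_gen_subalg]).  For k = 'F_p and #|G| = p ^ n this is n <= m.

    A standard subalgebra which is a polynomial ring in m variables is in
    particular generated by m elements, so n <= m; and its Krull dimension is
    at least m because the ideals (x_1, ..., x_i), 0 <= i <= m, form a strict
    chain of primes ([krull_dim_polynomial_ring]). *)

(** * Sums over a group and polynomial algebras *)

(** A sum of terms that are constant on the left cosets of <[g]>, each of
    which has #[g] elements. *)
Lemma sum_right_invariant_eq0 (R : pzRingType) (G : finGroupType) (g : G)
    (F : G -> R) :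
  (forall x, F (x * g)%g = F x) -> #[g]%g%:R = 0 :> R -> \sum_x F x = 0.
Proof.
move=> Fg g0.
have Fc x y : y \in <[g]>%g -> F (x * y)%g = F x.
  case/cycleP=> i ->; elim: i => [|i IH]; first by rewrite expg0 mulg1.
  by rewrite expgSr mulgA Fg.
rewrite (partition_big (fun x : G => (x *: <[g]>)%g) predT) //=.
apply: big1 => C _; case: (pickP (fun x : G => (x *: <[g]>)%g == C)); last first.
  by move=> C0; rewrite big_pred0.
move=> x /eqP <-.
have coset y : (y *: <[g]> == x *: <[g]>)%g = (y \in x *: <[g]>)%g.
  by apply/eqP/idP => [<-|/lcoset_eqP]; first exact: lcoset_refl.
rewrite (eq_bigl _ _ coset) (eq_bigr (fun=> F x)).
  by rewrite sumr_const card_lcoset -mulr_natr g0 mulr0.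
by move=> y /lcosetP[z zg ->]; exact: Fc.
Qed.

Lemma lrmorph_mpolyE (k : fieldType) (D : comAlgType k) (m : nat)
    (f : {lrmorphism {mpoly k[m]} -> D}) q :
  f q = mmap (in_alg D) (fun i => f 'X_i) q.
Proof.
rewrite [in LHS](mpolyE q) raddf_sum /mmap; apply: eq_bigr => mm _ /=.
rewrite linearZ /= mulr_algl; congr (_ *: _).
rewrite mpolyXE_id rmorph_prod /=; apply: eq_bigr => i _.
by rewrite rmorphXn.
Qed.

Lemma lrmorph_mmap (k : fieldType) (D : comAlgType k)
    (phi : {lrmorphism D -> k^o}) (m : nat) (a : 'I_m -> D) q :
  phi (mmap (in_alg D) a q) = q.@[fun i => phi (a i)].
Proof.
rewrite /meval /mmap raddf_sum; apply: eq_bigr => mm _ /=.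
rewrite mulr_algl linearZ /=; congr (_ * _).
by rewrite rmorph_prod /=; apply: eq_bigr => i _; rewrite rmorphXn.
Qed.

(** * Points of D_k and their orbits *)

Section Points.
Variables (k : fieldType) (G : finGroupType).
Local Notation D := (Dk k G).
Local Notation act := Defs.act.

Local Notation unit_vector :=
  (fun i : 'I_#|G| => (i == enum_rank 1%g)%:R : k).

(** The point X_1 = 1, X_g = 0 for g <> 1, which lies on the hyperplane
    alpha = 0 and so does define a point of the quotient D_k. *)
Definition Dk_point (x : D) : k^o := (generic_quotient.repr x).@[unit_vector].

Lemma meval_alpha : (alpha k G).@[unit_vector] = 0.
Proof.
rewrite /alpha mevalD mevalN meval1 raddf_sum /= (bigD1 1%g) //=.
rewrite mevalXU eqxx big1 ?addr0 ?addNr // => g /negPf g1.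
by rewrite mevalXU (inj_eq enum_rank_inj) g1.
Qed.

Lemma Dk_point_pi q : Dk_point (\pi_(D)%qT q) = q.@[unit_vector].
Proof.
apply/eqP; rewrite -subr_eq0 -mevalB.
have : generic_quotient.repr (\pi_(D)%qT q) - q \in @alpha_ideal k G.
  by rewrite Quotient.idealrBE generic_quotient.reprK.
by case/alpha_idealP => r ->; rewrite mevalM meval_alpha mulr0.
Qed.

Lemma Dk_point_is_zmod_morphism : zmod_morphism Dk_point.
Proof.
move=> x y; rewrite -[x]generic_quotient.reprK -[y]generic_quotient.reprK.
by rewrite -(raddfB (\pi_(D)%qT)) !Dk_point_pi mevalB.
Qed.

Lemma Dk_point_is_monoid_morphism : monoid_morphism Dk_point.
Proof.
split; first by rewrite -(rmorph1 (\pi_(D)%qT)) Dk_point_pi meval1.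
move=> x y; rewrite -[x]generic_quotient.reprK -[y]generic_quotient.reprK.
by rewrite -piDM !Dk_point_pi mevalM.
Qed.

Lemma Dk_point_is_scalable : scalable Dk_point.
Proof.
move=> c x; change (Dk_point (Dk_scale c x) = c *: Dk_point x).
by rewrite -[x]generic_quotient.reprK pi_scale !Dk_point_pi mevalZ.
Qed.

HB.instance Definition _ :=
  GRing.isZmodMorphism.Build D k^o Dk_point Dk_point_is_zmod_morphism.
HB.instance Definition _ :=
  GRing.isMonoidMorphism.Build D k^o Dk_point Dk_point_is_monoid_morphism.
HB.instance Definition _ :=
  GRing.isScalable.Build k D k^o *:%R Dk_point Dk_point_is_scalable.

(** The orbit of a point of k[a], in the coordinates given by a.  If h and h'
    move the point phi to the same point psi, then h * h'^-1 fixes psi, which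
    is impossible unless h = h', since psi (tr b) = 1 for some b. *)
Lemma orbit_map_inj (p : nat) (phi : {lrmorphism D -> k^o}) (m : nat)
    (a : 'I_m -> D) :
  p \in [pchar k] -> (p.-group [set: G])%g ->
  is_stable (gen_subalg a) -> is_trace_surjective (gen_subalg a) ->
  injective (fun h : G => [ffun i => phi (act h (a i)) : k]).
Proof.
move=> pk pG stab trs h h' /ffunP eq_a.
have eqA x : x \in gen_subalg a -> phi (act h x) = phi (act h' x).
  pose actphi (u : G) : {lrmorphism D -> k^o} := phi \o act u.
  case/gen_subalgP=> q ->.
  rewrite -[LHS]/(actphi h _) -[RHS]/(actphi h' _) !lrmorph_mmap.
  by apply: meval_eq => i; have := eq_a i; rewrite !ffunE.
have [b bA trb] : exists2 b, b \in gen_subalg a & tr b = 1.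
  apply: trs => [|u]; last exact: rmorph1.
  by apply/gen_subalgP; exists 1; rewrite rmorph1.
apply/eqP; rewrite eq_mulgV1; apply/negPn/negP => g_neq1.
set g := (h * h'^-1)%g in g_neq1.
have gk0 : #[g]%g%:R = 0 :> k^o.
  have : (p.-elt g)%g by apply: (mem_p_elt pG); rewrite inE.
  case/p_natP => -[|e] oge; first by rewrite -order_eq1 oge in g_neq1.
  by rewrite oge expnS natrM (pcharf0 pk) mul0r.
have : phi (act h' (tr b)) = 0.
  rewrite /tr !raddf_sum; apply: (sum_right_invariant_eq0 _ gk0) => x /=.
  have := eqA _ (stab x b bA).
  by rewrite -!Defs.actM -(mulgA x) mulgVK.
by rewrite trb !rmorph1 => /eqP; rewrite oner_eq0.
Qed.

End Points.

Lemma card_le_gen_subalg (k : finFieldType) (p : nat) (G : finGroupType)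
    (m : nat) (a : 'I_m -> Dk k G) :
  p \in [pchar k] -> (p.-group [set: G])%g ->
  is_stable (gen_subalg a) -> is_trace_surjective (gen_subalg a) ->
  (#|G| <= #|k| ^ m)%N.
Proof.
move=> pk pG stab trs.
have := leq_card _ (orbit_map_inj (phi := @Dk_point k G) pk pG stab trs).
by rewrite card_ffun card_ord.
Qed.

(** * Krull dimension of polynomial rings *)

Section VariableIdeals.
Variables (k : fieldType) (D : comAlgType k) (m : nat).
Variable f : {lrmorphism {mpoly k[m]} -> D}.

Definition kill_vars (i : nat) (q : {mpoly k[m]}) : {mpoly k[m]} :=
  q \mPo [tuple if (j < i)%N then 0 else 'X_j | j < m].

Lemma kill_vars_is_zmod_morphism i : zmod_morphism (kill_vars i).
Proof. by move=> q r; rewrite /kill_vars rmorphB. Qed.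

Lemma kill_vars_is_monoid_morphism i : monoid_morphism (kill_vars i).
Proof.
by split=> [|q r]; rewrite /kill_vars (rmorph1, rmorphM).
Qed.

HB.instance Definition _ i :=
  GRing.isZmodMorphism.Build {mpoly k[m]} {mpoly k[m]} (kill_vars i)
    (kill_vars_is_zmod_morphism i).
HB.instance Definition _ i :=
  GRing.isMonoidMorphism.Build {mpoly k[m]} {mpoly k[m]} (kill_vars i)
    (kill_vars_is_monoid_morphism i).

(** The image of the ideal (x_0, ..., x_(i-1)), described as the kernel of the
    substitution x_j = 0 for j < i: primality is then immediate, because the
    target of the substitution is an integral domain. *)
Definition variable_ideal (i : nat) : {pred D} :=
  fun x => `[< exists2 q, x = f q & kill_vars i q = 0 >].

Lemma variable_idealP i x :
  reflect (exists2 q, x = f q & kill_vars i q = 0) (x \in variable_ideal i).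
Proof. exact: asboolP. Qed.

Lemma kill_varsX i (j : 'I_m) :
  kill_vars i 'X_j = if (j < i)%N then 0 else 'X_j.
Proof. by rewrite /kill_vars comp_mpolyXU -tnth_nth tnth_mktuple. Qed.

Lemma kill_vars_le i j q :
  (i <= j)%N -> kill_vars j (kill_vars i q) = kill_vars j q.
Proof.
move=> ij; elim/mpolyind: q => [|c mm q _ _ IH]; first by rewrite !rmorph0.
move: IH; rewrite /kill_vars !rmorphD /= => ->; congr (_ + _).
rewrite !linearZ /=; congr (_ *: _).
rewrite !comp_mpolyX rmorph_prod /=; apply: eq_bigr => l _.
rewrite rmorphXn /= !tnth_mktuple; congr (_ ^+ _).
case: (ltnP l i) => [li|_]; first by rewrite rmorph0 (leq_trans li ij).
exact: kill_varsX.
Qed.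

Hypothesis f_inj : injective f.
Variable U : {pred D}.
Hypothesis UE : forall x, x \in U <-> exists q, x = f q.

Lemma variable_ideal_f i q : (f q \in variable_ideal i) = (kill_vars i q == 0).
Proof.
apply/variable_idealP/eqP => [[r /f_inj -> //]|q0]; by exists q.
Qed.

Lemma variable_ideal_prime i : is_prime_ideal_of U (variable_ideal i).
Proof.
split.
- by move=> x /variable_idealP[q -> _]; apply/UE; exists q.
- by rewrite -(rmorph0 f) variable_ideal_f rmorph0.
- by rewrite -(rmorph1 f) variable_ideal_f rmorph1 oner_eq0.
- move=> x /UE[q ->] _ _ /variable_idealP[r -> r0] /variable_idealP[s -> s0].
  rewrite -rmorphM -rmorphD variable_ideal_f rmorphD rmorphM /=.
  by rewrite r0 s0 mulr0 addr0.
- move=> _ _ /UE[q ->] /UE[r ->].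
  by rewrite -rmorphM !variable_ideal_f rmorphM mulf_eq0.
Qed.

Lemma krull_dim_polynomial_ring : krull_dim_ge U m.
Proof.
exists m => //; exists variable_ideal; split=> [i _|i im].
  exact: variable_ideal_prime.
split=> [x /variable_idealP[q -> q0]|].
  by rewrite variable_ideal_f -(kill_vars_le q (leqnSn i)) q0 rmorph0.
exists (f 'X_(Ordinal im)); rewrite variable_ideal_f kill_varsX /=.
  by rewrite leqnn.
by rewrite ltnn -msupp_eq0 msuppX.
Qed.

End VariableIdeals.

Theorem proposition5p5 (p n : nat) (G : finGroupType)
    (p_prime : prime p) (pG : (p.-group [set: G])%g)
    (cardG : #|G| = (p ^ n)%N) :
  (forall (m : nat) (a : 'I_m -> Dk 'F_p G),
     is_stable (gen_subalg a) -> is_trace_surjective (gen_subalg a) ->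
     (n <= m)%N)
  /\
  (forall U : {pred Dk 'F_p G},
     is_standard U -> is_polynomial_ring U -> krull_dim_ge U n).
Proof.
have bound (m : nat) (a : 'I_m -> Dk 'F_p G) :
    is_stable (gen_subalg a) -> is_trace_surjective (gen_subalg a) ->
    (n <= m)%N.
  move=> stab trs.
  have := card_le_gen_subalg (pchar_Fp p_prime) pG stab trs.
  by rewrite cardG card_Fp // leq_exp2l // prime_gt1.
split=> // U [[_ stabU] trsU _] [m [f [f_inj UE]]].
have genE : U =i gen_subalg (fun i => f 'X_i).
  move=> x; apply/idP/gen_subalgP => [/UE[q ->]|[q ->]].
    by exists q; exact: lrmorph_mpolyE.
  by apply/UE; exists q; rewrite lrmorph_mpolyE.
have nm : (n <= m)%N.
  apply: (bound m (fun i => f 'X_i)) => [g x|b].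
    by rewrite -!genE; exact: stabU.
  rewrite -genE => bU b_inv; have [c cU trc] := trsU b bU b_inv.
  by exists c; rewrite -?genE.
have [d md chain] := krull_dim_polynomial_ring f_inj UE.
by exists d => //; exact: leq_trans nm md.
Qed.
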